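(* Each symmetric Ann-category is a distributivity category (in the sense of Laplaza), where the null isomorphisms $\hat{L}^A:A\otimes0\to0$ and $\hat{R}^A:0\otimes A\to0$ are the unique isomorphisms compatible with the unit constraints of $\oplus$ (as specified in the context) and all the other structure is that of the symmetric Ann-category.
   Context: Write $AB$ for $A\otimes B$. An Ann-category consists of a category $\mathcal{A}$ with bifunctors $\oplus,\otimes:\mathcal{A}\times\mathcal{A}\to\mathcal{A}$ and: (i) an object $0$ (also written $O$) and natural isomorphisms $a^+_{X,Y,Z}:X\oplus(Y\oplus Z)\to(X\oplus Y)\oplus Z$, $c^+_{X,Y}:X\oplus Y\to Y\oplus X$, $g_X:0\oplus X\to X$, $d_X:X\oplus0\to X$ making $(\mathcal{A},\oplus)$ a symmetric categorical group, i.e. a symmetric monoidal category that is a groupoid and in which every object $X$ has an object $X'$ with $X\oplus X'\cong 0$; (ii) an object $1$ and natural isomorphisms $a_{A,B,C}:A(BC)\to(AB)C$, $l_X:1X\to X$, $r_X:X1\to X$ making $(\mathcal{A},\otimes)$ a monoidal category; (iii) natural isomorphisms $\mathfrak{L}_{A,X,Y}:A(X\oplus Y)\to AX\oplus AY$ and $\mathfrak{R}_{X,Y,A}:(X\oplus Y)A\to XA\oplus YA$, such that the following hold for all objects. (Ann-1) The functors $A\otimes-$ (with $\mathfrak{L}_{A,-,-}$) and $-\otimes A$ (with $\mathfrak{R}_{-,-,A}$) are compatible with $a^+$ and $c^+$: $(\mathfrak{L}_{A,X,Y}\oplus \mathrm{id})\mathfrak{L}_{A,X\oplus Y,Z}(\mathrm{id}_A\otimes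 a^+_{X,Y,Z})=a^+_{AX,AY,AZ}(\mathrm{id}\oplus\mathfrak{L}_{A,Y,Z})\mathfrak{L}_{A,X,Y\oplus Z}$ and $c^+_{AX,AY}\mathfrak{L}_{A,X,Y}=\mathfrak{L}_{A,Y,X}(\mathrm{id}_A\otimes c^+_{X,Y})$, and likewise $(\mathfrak{R}_{X,Y,A}\oplus \mathrm{id})\mathfrak{R}_{X\oplus Y,Z,A}(a^+_{X,Y,Z}\otimes \mathrm{id}_A)=a^+_{XA,YA,ZA}(\mathrm{id}\oplus\mathfrak{R}_{Y,Z,A})\mathfrak{R}_{X,Y\oplus Z,A}$ and $c^+_{XA,YA}\mathfrak{R}_{X,Y,A}=\mathfrak{R}_{Y,X,A}(c^+_{X,Y}\otimes \mathrm{id}_A)$. (Ann-2) (1) $\mathfrak{L}_{AB,X,Y}\circ a_{A,B,X\oplus Y}=(a_{A,B,X}\oplus a_{A,B,Y})\circ\mathfrak{L}_{A,BX,BY}\circ(\mathrm{id}_A\otimes\mathfrak{L}_{B,X,Y})$; (2) $(a_{X,B,A}\oplus a_{Y,B,A})\circ\mathfrak{R}_{X,Y,BA}=\mathfrak{R}_{XB,YB,A}\circ(\mathfrak{R}_{X,Y,B}\otimes \mathrm{id}_A)\circ a_{X\oplus Y,B,A}$; (3) $\mathfrak{R}_{AX,AY,B}\circ(\mathfrak{L}_{A,X,Y}\otimes \mathrm{id}_B)\circ a_{A,X\oplus Y,B}=(a_{A,X,B}\oplus a_{A,Y,B})\circ\mathfrak{L}_{A,XB,YB}\circ(\mathrm{id}_A\otimes\mathfrak{R}_{X,Y,B})$;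 (4) $v\circ(\mathfrak{R}_{A,B,X}\oplus\mathfrak{R}_{A,B,Y})\circ\mathfrak{L}_{A\oplus B,X,Y}=(\mathfrak{L}_{A,X,Y}\oplus\mathfrak{L}_{B,X,Y})\circ\mathfrak{R}_{A,B,X\oplus Y}$, where $v=v_{U,V,Z,T}:(U\oplus V)\oplus(Z\oplus T)\to(U\oplus Z)\oplus(V\oplus T)$ is the canonical isomorphism built from $a^+,c^+,\mathrm{id}$ (interchanging $V$ and $Z$). (Ann-3) (5.1) $(l_X\oplus l_Y)\circ\mathfrak{L}_{1,X,Y}=l_{X\oplus Y}$; (5.2) $(r_X\oplus r_Y)\circ\mathfrak{R}_{X,Y,1}=r_{X\oplus Y}$. A symmetric Ann-category is an Ann-category with a natural isomorphism $c_{A,B}:AB\to BA$ such that $(\mathcal{A},\otimes,a,c,(1,l,r))$ is a symmetric monoidal category, with $c_{0,0}=\mathrm{id}$ and (6) $\mathfrak{R}_{X,Y,A}\circ c_{A,X\oplus Y}=(c_{A,X}\oplus c_{A,Y})\circ\mathfrak{L}_{A,X,Y}$. It is known that in any Ann-category there are, for each object $A$, unique isomorphisms $\hat{L}^A:A0\to0$ and $\hat{R}^A:0A\to0$ compatible with the unit constraints of $\oplus$, i.e. satisfying (L10)–(L13) below. A distributivity category is a category $\mathcal{A}$ with bifunctors $\otimes,\oplus$, objects $O$ and $1$, natural isomorphisms $a,c,l,r,a^+,c^+,g,d,\mathfrak{L},\mathfrak{R}$ of the types above and natural isomorphisms $\hat{L}^A:AO\to O$, $\hat{R}^A:OA\to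 O$, such that $(\mathcal{A},\otimes,a,c,(1,l,r))$ and $(\mathcal{A},\oplus,a^+,c^+,(O,g,d))$ are symmetric monoidal categories, the compatibility conditions in (Ann-1) and the identities (1), (2), (3), (4), (5.1), (5.2), (6) hold, and for all objects $A,B$: (L1) $\hat{L}^O=\hat{R}^O$; (L2) $g_O(\hat{R}^A\oplus\hat{R}^B)\mathfrak{L}_{O,A,B}=\hat{R}^{A\oplus B}$; (L3) $d_O(\hat{L}^A\oplus\hat{L}^B)\mathfrak{R}_{A,B,O}=\hat{L}^{A\oplus B}$; (L4) $\hat{L}^1=l_O:1O\to O$; (L5) $\hat{R}^1=r_O:O1\to O$; (L6) $\hat{L}^A=\hat{R}^A\circ c_{A,O}$; (L7) $\hat{R}^{AB}=\hat{R}^B(\hat{R}^A\otimes \mathrm{id}_B)a_{O,A,B}$; (L8) $\hat{L}^A(\mathrm{id}_A\otimes\hat{R}^B)=\hat{R}^B(\hat{L}^A\otimes \mathrm{id}_B)a_{A,O,B}$; (L9) $\hat{L}^{AB}a_{A,B,O}=\hat{L}^A(\mathrm{id}_A\otimes\hat{L}^B)$; (L10) $g_{AB}(\hat{L}^A\oplus \mathrm{id}_{AB})\mathfrak{L}_{A,O,B}=\mathrm{id}_A\otimes g_B$; (L11) $g_{BA}(\hat{R}^A\oplus \mathrm{id}_{BA})\mathfrak{R}_{O,B,A}=g_B\otimes \mathrm{id}_A$; (L12) $d_{AB}(\mathrm{id}_{AB}\oplus\hat{L}^A)\mathfrak{L}_{A,B,O}=\mathrm{id}_A\otimes d_B$;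 (L13) $d_{AB}(\mathrm{id}_{AB}\oplus\hat{R}^B)\mathfrak{R}_{A,O,B}=d_A\otimes \mathrm{id}_B$. *)

(* Defs.v *)
Set Implicit Arguments.
Unset Strict Implicit.
Unset Printing Implicit Defensive.

(** * Categories, isomorphisms, bifunctors *)

Record Category := {
  Obj :> Type;
  Hom : Obj -> Obj -> Type;
  idm : forall X : Obj, Hom X X;
  comp : forall X Y Z : Obj, Hom Y Z -> Hom X Y -> Hom X Z;
  comp_id_l : forall (X Y : Obj) (f : Hom X Y), comp (idm Y) f = f;
  comp_id_r : forall (X Y : Obj) (f : Hom X Y), comp f (idm X) = f;
  comp_assoc : forall (X Y Z T : Obj) (h : Hom Z T) (g : Hom Y Z) (f : Hom X Y),
    comp h (comp g f) = comp (comp h g) f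
}.

Arguments Hom {_} _ _.
Arguments idm {_} X.
Arguments comp {_ X Y Z} g f : rename.

Notation "g ∘ f" := (comp g f) (at level 40, left associativity).

Record Iso (C : Category) (X Y : C) := {
  fwd :> Hom X Y;
  bwd : Hom Y X;
  bwd_fwd : bwd ∘ fwd = idm X;
  fwd_bwd : fwd ∘ bwd = idm Y
}.

Arguments Iso {C} X Y.

Definition is_groupoid (C : Category) : Prop :=
  forall (X Y : C) (f : Hom X Y),
    exists g : Hom Y X, g ∘ f = idm X /\ f ∘ g = idm Y.

Record Bifunctor (C : Category) := {
  bobj :> C -> C -> C;
  bmap : forall X X' Y Y' : C,
    Hom X X' -> Hom Y Y' -> Hom (bobj X Y) (bobj X' Y');
  bmap_id : forall X Y : C, bmap (idm X) (idm Y) = idm (bobj X Y);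
  bmap_comp : forall (X X' X'' Y Y' Y'' : C)
      (f' : Hom X' X'') (f : Hom X X') (g' : Hom Y' Y'') (g : Hom Y Y'),
    bmap (f' ∘ f) (g' ∘ g) = bmap f' g' ∘ bmap f g
}.

Arguments bmap {C} _ {X X' Y Y'} f g : rename.

(** * Monoidal and symmetric monoidal structures *)

(* The associator is oriented X(YZ) -> (XY)Z. *)
Record Monoidal (C : Category) := {
  tens :> Bifunctor C;
  unit : C;
  assoc : forall X Y Z : C, Iso (tens X (tens Y Z)) (tens (tens X Y) Z);
  lunit : forall X : C, Iso (tens unit X) X;
  runit : forall X : C, Iso (tens X unit) X;
  assoc_nat : forall (X X' Y Y' Z Z' : C)
      (f : Hom X X') (g : Hom Y Y') (h : Hom Z Z'),
    assoc X' Y' Z' ∘ bmap tens f (bmap tens g h)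
    = bmap tens (bmap tens f g) h ∘ assoc X Y Z;
  lunit_nat : forall (X X' : C) (f : Hom X X'),
    lunit X' ∘ bmap tens (idm unit) f = f ∘ lunit X;
  runit_nat : forall (X X' : C) (f : Hom X X'),
    runit X' ∘ bmap tens f (idm unit) = f ∘ runit X;
  pentagon : forall X Y Z T : C,
    assoc (tens X Y) Z T ∘ assoc X Y (tens Z T)
    = bmap tens (assoc X Y Z) (idm T) ∘ assoc X (tens Y Z) T
      ∘ bmap tens (idm X) (assoc Y Z T);
  triangle : forall X Y : C,
    bmap tens (runit X) (idm Y) ∘ assoc X unit Y
    = bmap tens (idm X) (lunit Y)
}.

Arguments unit {C} _.
Arguments assoc {C} _ X Y Z.
Arguments lunit {C} _ X.
Arguments runit {C} _ X.

Record Symmetry (C : Category) (M : Monoidal C) := {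
  braid : forall X Y : C, Iso (M X Y) (M Y X);
  braid_nat : forall (X X' Y Y' : C) (f : Hom X X') (g : Hom Y Y'),
    braid X' Y' ∘ bmap M f g = bmap M g f ∘ braid X Y;
  hexagon : forall X Y Z : C,
    assoc M Z X Y ∘ braid (M X Y) Z ∘ assoc M X Y Z
    = bmap M (braid X Z) (idm Y) ∘ assoc M X Z Y ∘ bmap M (idm X) (braid Y Z);
  braid_invol : forall X Y : C, braid Y X ∘ braid X Y = idm (M X Y)
}.

Arguments braid {C M} _ X Y.

Definition has_opposites (C : Category) (M : Monoidal C) : Prop :=
  forall X : C, exists X' : C, inhabited (Iso (M X X') (unit M)).

(** * Two monoidal structures linked by distributivity isomorphisms *)

Record DistrData := {
  cat :> Category;
  add : Monoidal cat;
  add_sym : Symmetry add;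
  mul : Monoidal cat;
  distl : forall A X Y : cat,
    Iso (mul A (add X Y)) (add (mul A X) (mul A Y));
  distr : forall X Y A : cat,
    Iso (mul (add X Y) A) (add (mul X A) (mul Y A));
  distl_nat : forall (A A' X X' Y Y' : cat)
      (f : Hom A A') (g : Hom X X') (h : Hom Y Y'),
    distl A' X' Y' ∘ bmap mul f (bmap add g h)
    = bmap add (bmap mul f g) (bmap mul f h) ∘ distl A X Y;
  distr_nat : forall (X X' Y Y' A A' : cat)
      (g : Hom X X') (h : Hom Y Y') (f : Hom A A'),
    distr X' Y' A' ∘ bmap mul (bmap add g h) f
    = bmap add (bmap mul g f) (bmap mul h f) ∘ distr X Y A
}.

Arguments add {_}.
Arguments add_sym {_}.
Arguments mul {_}.
Arguments distl {_} A X Y.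
Arguments distr {_} X Y A.

Notation "X ⊕ Y" := (bobj (tens add) X Y) (at level 50, left associativity).
Notation "X ⊗ Y" := (bobj (tens mul) X Y) (at level 40, left associativity).
Notation "f ⊕m g" := (bmap (tens add) f g) (at level 38, left associativity).
Notation "f ⊗m g" := (bmap (tens mul) f g) (at level 38, left associativity).
Notation "'zero'" := (unit add).
Notation "'one'" := (unit mul).
Notation "'𝔏'" := distl.
Notation "'ℜ'" := distr.
Notation "'a⁺'" := (assoc add).
Notation "'c⁺'" := (braid add_sym).
Notation "'g⁺'" := (lunit add).
Notation "'d⁺'" := (runit add).
Notation "'a×'" := (assoc mul).
Notation "'l×'" := (lunit mul).
Notation "'r×'" := (runit mul).

Section Conditions.
Variable D : DistrData.

Definition Ann1 : Prop :=
  (forall A X Y Z : D,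
     (𝔏 A X Y ⊕m idm (A ⊗ Z)) ∘ 𝔏 A (X ⊕ Y) Z ∘ (idm A ⊗m a⁺ X Y Z)
     = a⁺ (A ⊗ X) (A ⊗ Y) (A ⊗ Z) ∘ (idm (A ⊗ X) ⊕m 𝔏 A Y Z) ∘ 𝔏 A X (Y ⊕ Z))
  /\ (forall A X Y : D,
     c⁺ (A ⊗ X) (A ⊗ Y) ∘ 𝔏 A X Y = 𝔏 A Y X ∘ (idm A ⊗m c⁺ X Y))
  /\ (forall X Y Z A : D,
     (ℜ X Y A ⊕m idm (Z ⊗ A)) ∘ ℜ (X ⊕ Y) Z A ∘ (a⁺ X Y Z ⊗m idm A)
     = a⁺ (X ⊗ A) (Y ⊗ A) (Z ⊗ A) ∘ (idm (X ⊗ A) ⊕m ℜ Y Z A) ∘ ℜ X (Y ⊕ Z) A)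
  /\ (forall X Y A : D,
     c⁺ (X ⊗ A) (Y ⊗ A) ∘ ℜ X Y A = ℜ Y X A ∘ (c⁺ X Y ⊗m idm A)).

(* The composite (UV)(ZT) -> U(V(ZT)) -> U((VZ)T) -> U((ZV)T) -> U(Z(VT))
   -> (UZ)(VT); by coherence the bracketing route is immaterial. *)
Definition interchange (U V Z T : D) :
    Hom ((U ⊕ V) ⊕ (Z ⊕ T)) ((U ⊕ Z) ⊕ (V ⊕ T)) :=
  a⁺ U Z (V ⊕ T)
  ∘ (idm U ⊕m bwd (a⁺ Z V T))
  ∘ (idm U ⊕m (c⁺ V Z ⊕m idm T))
  ∘ (idm U ⊕m a⁺ V Z T)
  ∘ bwd (a⁺ U V (Z ⊕ T)).

Definition Ann2 : Prop :=
  (forall A B X Y : D,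
     𝔏 (A ⊗ B) X Y ∘ a× A B (X ⊕ Y)
     = (a× A B X ⊕m a× A B Y) ∘ 𝔏 A (B ⊗ X) (B ⊗ Y) ∘ (idm A ⊗m 𝔏 B X Y))
  /\ (forall X Y B A : D,
     (a× X B A ⊕m a× Y B A) ∘ ℜ X Y (B ⊗ A)
     = ℜ (X ⊗ B) (Y ⊗ B) A ∘ (ℜ X Y B ⊗m idm A) ∘ a× (X ⊕ Y) B A)
  /\ (forall A X Y B : D,
     ℜ (A ⊗ X) (A ⊗ Y) B ∘ (𝔏 A X Y ⊗m idm B) ∘ a× A (X ⊕ Y) B
     = (a× A X B ⊕m a× A Y B) ∘ 𝔏 A (X ⊗ B) (Y ⊗ B) ∘ (idm A ⊗m ℜ X Y B))
  /\ (forall A B X Y : D,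
     interchange (A ⊗ X) (B ⊗ X) (A ⊗ Y) (B ⊗ Y)
       ∘ (ℜ A B X ⊕m ℜ A B Y) ∘ 𝔏 (A ⊕ B) X Y
     = (𝔏 A X Y ⊕m 𝔏 B X Y) ∘ ℜ A B (X ⊕ Y)).

Definition Ann3 : Prop :=
  (forall X Y : D, (l× X ⊕m l× Y) ∘ 𝔏 one X Y = l× (X ⊕ Y))
  /\ (forall X Y : D, (r× X ⊕m r× Y) ∘ ℜ X Y one = r× (X ⊕ Y)).

Definition dist_sym_compat (c : Symmetry (@mul D)) : Prop :=
  forall A X Y : D,
    ℜ X Y A ∘ braid c A (X ⊕ Y) = (braid c A X ⊕m braid c A Y) ∘ 𝔏 A X Y.

Definition L10 (A : D) (h : Hom (A ⊗ zero) zero) : Prop :=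
  forall B : D,
    g⁺ (A ⊗ B) ∘ (h ⊕m idm (A ⊗ B)) ∘ 𝔏 A zero B = idm A ⊗m g⁺ B.

Definition L11 (A : D) (h : Hom (zero ⊗ A) zero) : Prop :=
  forall B : D,
    g⁺ (B ⊗ A) ∘ (h ⊕m idm (B ⊗ A)) ∘ ℜ zero B A = g⁺ B ⊗m idm A.

Definition L12 (A : D) (h : Hom (A ⊗ zero) zero) : Prop :=
  forall B : D,
    d⁺ (A ⊗ B) ∘ (idm (A ⊗ B) ⊕m h) ∘ 𝔏 A B zero = idm A ⊗m d⁺ B.

Definition L13 (B : D) (h : Hom (zero ⊗ B) zero) : Prop :=
  forall A : D,
    d⁺ (A ⊗ B) ∘ (idm (A ⊗ B) ⊕m h) ∘ ℜ A zero B = d⁺ A ⊗m idm B.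

End Conditions.

(** * Ann-categories and distributivity categories *)

Record AnnCategory := {
  ann_data :> DistrData;
  ann_groupoid : is_groupoid ann_data;
  ann_opposites : has_opposites (@add ann_data);
  ann_1 : Ann1 ann_data;
  ann_2 : Ann2 ann_data;
  ann_3 : Ann3 ann_data
}.

Record SymAnnCategory := {
  sann :> AnnCategory;
  sann_sym : Symmetry (@mul sann);
  sann_sym_zero : fwd (braid sann_sym zero zero) = idm (zero ⊗ zero);
  sann_compat : dist_sym_compat sann_sym
}.

(* What the two given monoidal structures, the distributivity isomorphisms and
   the symmetry [c] of ⊗ still need in order to form a distributivity category:
   the null isomorphisms, and all the conditions. *)
Record DistributivityCategoryOn (D : DistrData) (c : Symmetry (@mul D)) := {
  dc_1 : Ann1 D;
  dc_2 : Ann2 D;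
  dc_3 : Ann3 D;
  dc_compat : dist_sym_compat c;
  nullL : forall A : D, Iso (A ⊗ zero) zero;
  nullR : forall A : D, Iso (zero ⊗ A) zero;
  nullL_nat : forall (A A' : D) (f : Hom A A'),
    nullL A' ∘ (f ⊗m idm zero) = nullL A;
  nullR_nat : forall (A A' : D) (f : Hom A A'),
    nullR A' ∘ (idm zero ⊗m f) = nullR A;
  dc_L1 : fwd (nullL zero) = fwd (nullR zero);
  dc_L2 : forall A B : D,
    g⁺ zero ∘ (nullR A ⊕m nullR B) ∘ 𝔏 zero A B = nullR (A ⊕ B);
  dc_L3 : forall A B : D,
    d⁺ zero ∘ (nullL A ⊕m nullL B) ∘ ℜ A B zero = nullL (A ⊕ B);
  dc_L4 : fwd (nullL one) = fwd (l× zero);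
  dc_L5 : fwd (nullR one) = fwd (r× zero);
  dc_L6 : forall A : D, fwd (nullL A) = nullR A ∘ braid c A zero;
  dc_L7 : forall A B : D,
    fwd (nullR (A ⊗ B)) = nullR B ∘ (nullR A ⊗m idm B) ∘ a× zero A B;
  dc_L8 : forall A B : D,
    nullL A ∘ (idm A ⊗m nullR B)
    = nullR B ∘ (nullL A ⊗m idm B) ∘ a× A zero B;
  dc_L9 : forall A B : D,
    nullL (A ⊗ B) ∘ a× A B zero = nullL A ∘ (idm A ⊗m nullL B);
  dc_L10 : forall A : D, L10 (nullL A);
  dc_L11 : forall A : D, L11 (nullR A);
  dc_L12 : forall A : D, L12 (nullL A);
  dc_L13 : forall B : D, L13 (nullR B)
}.

(* Main.v *)
From Stdlib Require Import ClassicalEpsilon.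
Require Import Defs.

Set Implicit Arguments.
Unset Strict Implicit.
Unset Printing Implicit Defensive.

(** The null isomorphism of [A] is the comparison [F 0 → 0] of the additive
    functor [F = A ⊗ -] or [F = - ⊗ A].  In a categorical group translations
    [- ⊕ Y] are fully faithful, so such a comparison exists and is already
    determined by its compatibility with the left unit constraint at a single
    object.  Moreover it is preserved by every natural transformation respecting
    the additivity constraints.  The axioms (1), (2), (3), (4), (5.1), (5.2),
    (6) say exactly that associators, distributors, unit constraints and the
    symmetry are such transformations, which yields (L2) and (L4)-(L9); then
    (L1) is (L6) at [0] together with [c_{0,0} = id], and (L3) follows from (L2)
    by (L6). *)

(** * Composites, squares and cancellation in a category *)

Lemma comp_pre (C : Category) (X Y Z T : C) (f : Hom Y Z) (g : Hom X Y)
    (w : Hom X Z) (e : f ∘ g = w) (t : Hom Z T) : t ∘ f ∘ g = t ∘ w.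
Proof. now rewrite <- comp_assoc, e. Qed.

(** Composites are kept nested to the left, so a pair [f ∘ g] inside a longer composite occurs as
    [t ∘ f ∘ g]; [comp_pre] makes it rewritable. *)
Ltac rw H := rewrite ?comp_assoc;
  first [rewrite H | rewrite (comp_pre H)]; rewrite ?comp_assoc.
Ltac rwb H := rw (eq_sym H).

Section Bifunctors.
Variables (C : Category) (M : Bifunctor C).

Lemma bmap_l (X Y Z W : C) (g : Hom Y Z) (f : Hom X Y) :
  bmap M (g ∘ f) (idm W) = bmap M g (idm W) ∘ bmap M f (idm W).
Proof. now rewrite <- bmap_comp, comp_id_l. Qed.

Lemma bmap_r (X Y Z W : C) (g : Hom Y Z) (f : Hom X Y) :
  bmap M (idm W) (g ∘ f) = bmap M (idm W) g ∘ bmap M (idm W) f.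
Proof. now rewrite <- bmap_comp, comp_id_l. Qed.

Lemma bmap_lr (X X' Y Y' : C) (f : Hom X X') (g : Hom Y Y') :
  bmap M f (idm Y') ∘ bmap M (idm X) g = bmap M f g.
Proof. now rewrite <- bmap_comp, comp_id_l, comp_id_r. Qed.

Lemma bmap_rl (X X' Y Y' : C) (f : Hom X X') (g : Hom Y Y') :
  bmap M (idm X') g ∘ bmap M f (idm Y) = bmap M f g.
Proof. now rewrite <- bmap_comp, comp_id_l, comp_id_r. Qed.

End Bifunctors.

Lemma paste (C : Category) (X Y Z X' Y' Z' : C) (p : Hom Y' Z') (p0 : Hom Y Z)
    (q : Hom X' Y') (q0 : Hom X Y) (x : Hom X X') (y : Hom Y Y') (z : Hom Z Z') :
  p ∘ y = z ∘ p0 -> q ∘ x = y ∘ q0 -> (p ∘ q) ∘ x = z ∘ (p0 ∘ q0).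
Proof.
intros e1 e2. now rewrite <- comp_assoc, e2, comp_assoc, e1, comp_assoc.
Qed.

Lemma whisker (C : Category) (M : Bifunctor C) (W W' X X' Y Y' : C)
    (f : Hom W W') (x : Hom X X') (y : Hom Y Y') (p : Hom X' Y') (p0 : Hom X Y) :
  p ∘ x = y ∘ p0 ->
  bmap M (idm W') p ∘ bmap M f x = bmap M f y ∘ bmap M (idm W) p0.
Proof.
intro e. now rewrite <- !bmap_comp, e, comp_id_l, comp_id_r.
Qed.

Lemma bwd_nat (C : Category) (X X' Y Y' : C) (i : Iso X Y) (i' : Iso X' Y')
    (f : Hom X X') (g : Hom Y Y') :
  i' ∘ f = g ∘ i -> bwd i' ∘ g = f ∘ bwd i.
Proof.
intro e.
rewrite <- (comp_id_r g), <- (fwd_bwd i), (comp_assoc g), <- e.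
now rewrite !comp_assoc, bwd_fwd, comp_id_l.
Qed.

Section Groupoids.
Variables (C : Category) (G : is_groupoid C).

Lemma cancel_l (X Y Z : C) (f : Hom Y Z) (g h : Hom X Y) :
  f ∘ g = f ∘ h -> g = h.
Proof.
intro e. destruct (G f) as [k [kf _]].
now rewrite <- (comp_id_l g), <- (comp_id_l h), <- kf, <- !comp_assoc, e.
Qed.

Lemma cancel_r (X Y Z : C) (f : Hom X Y) (g h : Hom Y Z) :
  g ∘ f = h ∘ f -> g = h.
Proof.
intro e. destruct (G f) as [k [_ fk]].
now rewrite <- (comp_id_r g), <- (comp_id_r h), <- fk, !comp_assoc, e.
Qed.

Lemma groupoid_iso (X Y : C) (f : Hom X Y) : exists i : Iso X Y, fwd i = f.
Proof.
destruct (G f) as [g [gf fg]].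
now exists {| fwd := f; bwd := g; bwd_fwd := gf; fwd_bwd := fg |}.
Qed.

End Groupoids.

(** * Coherence of units *)

Section Units.
Variables (C : Category) (G : is_groupoid C) (M : Monoidal C).

Local Notation I := (unit M).
Local Notation "f ⊞ g" := (bmap M f g) (at level 38, left associativity).

Lemma unit_tens_faithful (X Y : C) (f g : Hom X Y) :
  idm I ⊞ f = idm I ⊞ g -> f = g.
Proof.
intro e. apply (cancel_r G) with (f := fwd (lunit M X)).
now rewrite <- !lunit_nat, e.
Qed.

Lemma tens_unit_faithful (X Y : C) (f g : Hom X Y) :
  f ⊞ idm I = g ⊞ idm I -> f = g.
Proof.
intro e. apply (cancel_r G) with (f := fwd (runit M X)).
now rewrite <- !runit_nat, e.
Qed.

(** Kelly's argument: [I ⊞ -] is faithful, and after applying it the identity follows from the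
    pentagon at [I, I, X, Y] and two triangles. [runit_tens] is the mirror image. *)
Lemma lunit_tens (X Y : C) :
  (lunit M X ⊞ idm Y) ∘ assoc M I X Y = lunit M (M X Y).
Proof.
apply unit_tens_faithful, (cancel_l G) with (f := fwd (assoc M I X Y)).
rewrite bmap_r. rw (assoc_nat M (idm I) (lunit M X) (idm Y)).
rewrite <- !triangle, bmap_l, <- bmap_id.
rw (assoc_nat M (runit M I) (idm X) (idm Y)).
now rw (pentagon M I I X Y).
Qed.

Lemma runit_tens (X Y : C) :
  runit M (M X Y) ∘ assoc M X Y I = idm X ⊞ runit M Y.
Proof.
apply tens_unit_faithful.
apply (cancel_r G) with (f := fwd (assoc M X (M Y I) I)).
apply (cancel_r G) with (f := idm X ⊞ assoc M Y I I).
rewrite bmap_l.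
rwb (assoc_nat M (idm X) (runit M Y) (idm I)).
rewrite <- (comp_assoc (assoc M X Y I)), <- bmap_r, triangle.
rw (assoc_nat M (idm X) (idm Y) (lunit M I)).
rewrite bmap_id, <- triangle, <- !comp_assoc.
f_equal. rewrite !comp_assoc. symmetry. apply pentagon.
Qed.

Lemma lunit_unit : fwd (lunit M I) = runit M I.
Proof.
apply tens_unit_faithful, (cancel_r G) with (f := fwd (assoc M I I I)).
rewrite lunit_tens, triangle.
apply (cancel_l G) with (f := fwd (lunit M I)).
symmetry. apply lunit_nat.
Qed.

Variable S : Symmetry M.

(** After tensoring with [I] and composing with a braiding, this is the hexagon at [I, I, X] with
    the units absorbed. *)
Lemma runit_braid (X : C) : runit M X ∘ braid S I X = lunit M X.
Proof.
apply unit_tens_faithful, (cancel_l G) with (f := fwd (braid S I X)).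
rewrite <- triangle, bmap_r, <- runit_tens.
rewrite !comp_assoc, <- runit_nat.
assert (e := hexagon S I I X).
rewrite <- (comp_assoc (runit M (M X I)) (braid S I X ⊞ idm I)).
rewrite <- comp_assoc, <- (comp_assoc (braid S I X ⊞ idm I)).
rewrite (comp_assoc (braid S I X ⊞ idm I)), <- e, !comp_assoc, runit_tens.
now rewrite <- braid_nat.
Qed.

Lemma lunit_braid (X : C) : lunit M X ∘ braid S X I = runit M X.
Proof.
now rewrite <- runit_braid, <- comp_assoc, braid_invol, comp_id_r.
Qed.

End Units.

(** * Translations in a categorical group *)

Section Translations.
Variables (C : Category) (G : is_groupoid C) (M : Monoidal C) (S : Symmetry M).

Local Notation I := (unit M).
Local Notation "f ⊞ g" := (bmap M f g) (at level 38, left associativity).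

(* [(- ⊕ Y) ⊕ Y'] is isomorphic to the identity functor through this map. *)
Definition translate_back (Y Y' : C) (u : Hom (M Y Y') I) (X : C) :
    Hom (M (M X Y) Y') X :=
  runit M X ∘ (idm X ⊞ u) ∘ bwd (assoc M X Y Y').

Lemma translate_back_nat (Y Y' : C) (u : Hom (M Y Y') I) (X X' : C)
    (f : Hom X X') :
  translate_back u X' ∘ ((f ⊞ idm Y) ⊞ idm Y') = f ∘ translate_back u X.
Proof.
apply (cancel_r G) with (f := fwd (assoc M X Y Y')). unfold translate_back.
rewrite <- !comp_assoc, bwd_fwd, comp_id_r, <- assoc_nat, bmap_id.
rewrite (comp_assoc (bwd _)), bwd_fwd, comp_id_l, bmap_rl, <- bmap_lr.
now rewrite !comp_assoc, runit_nat.
Qed.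

Lemma translate_faithful_inv (Y Y' : C) (u : Hom (M Y Y') I) (X X' : C)
    (f g : Hom X X') :
  f ⊞ idm Y = g ⊞ idm Y -> f = g.
Proof.
intro e. apply (cancel_r G) with (f := translate_back u X).
now rewrite <- !translate_back_nat, e.
Qed.

Hypothesis O : has_opposites M.

Lemma translate_faithful (Y X X' : C) (f g : Hom X X') :
  f ⊞ idm Y = g ⊞ idm Y -> f = g.
Proof.
destruct (O Y) as [Y' [u]]. exact (translate_faithful_inv u (f:=f) (g:=g)).
Qed.

(** The preimage of [k] is [k ⊞ idm Y'] conjugated by [translate_back]; that it maps to [k] is
    checked after translating by [Y'], which is faithful. *)
Lemma translate_full (Y X X' : C) (k : Hom (M X Y) (M X' Y)) :
  exists f : Hom X X', f ⊞ idm Y = k.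
Proof.
destruct (O Y) as [Y' [u]].
destruct (G (translate_back u X)) as [t [tl tr]].
exists (translate_back u X' ∘ (k ⊞ idm Y') ∘ t).
apply (@translate_faithful Y').
apply (cancel_l G) with (f := translate_back u X').
rewrite translate_back_nat.
now rewrite <- !comp_assoc, tl, comp_id_r.
Qed.

End Translations.

(** * Additive functors and their unit comparisons *)

(** Meant for groupoids: there [mu] is invertible, and preservation of identities follows by
    cancellation ([fmap_id]). *)
Record AddFunctor (C : Category) (M : Monoidal C) := {
  fobj :> C -> C;
  fmap : forall X Y : C, Hom X Y -> Hom (fobj X) (fobj Y);
  fmap_comp : forall (X Y Z : C) (g : Hom Y Z) (f : Hom X Y),
    fmap (g ∘ f) = fmap g ∘ fmap f;
  mu : forall X Y : C, Hom (fobj (M X Y)) (M (fobj X) (fobj Y));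
  mu_nat : forall (X X' Y Y' : C) (f : Hom X X') (g : Hom Y Y'),
    mu X' Y' ∘ fmap (bmap M f g) = bmap M (fmap f) (fmap g) ∘ mu X Y
}.

Arguments fmap {C M} _ {X Y} f.
Arguments mu {C M} _ X Y.

Lemma fmap_id (C : Category) (G : is_groupoid C) (M : Monoidal C)
    (F : AddFunctor M) (X : C) : fmap F (idm X) = idm (F X).
Proof.
apply (cancel_l G) with (f := fmap F (idm X)).
now rewrite <- fmap_comp, !comp_id_r.
Qed.

(** For the functors [A ⊗ -] and [- ⊗ A] this unfolds to (L10) and (L11). *)
Definition unit_compat (C : Category) (M : Monoidal C) (F : AddFunctor M)
    (h : Hom (F (unit M)) (unit M)) : Prop :=
  forall B : C,
    lunit M (F B) ∘ bmap M h (idm (F B)) ∘ mu F (unit M) B = fmap F (lunit M B).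

Definition assoc_compat (C : Category) (M : Monoidal C) (F : AddFunctor M) : Prop :=
  forall X Y Z : C,
    bmap M (mu F X Y) (idm (F Z)) ∘ mu F (M X Y) Z ∘ fmap F (assoc M X Y Z)
    = assoc M (F X) (F Y) (F Z) ∘ bmap M (idm (F X)) (mu F Y Z) ∘ mu F X (M Y Z).

Section UnitComparison.
Variables (C : Category) (G : is_groupoid C) (M : Monoidal C).
Hypothesis O : has_opposites M.

Local Notation I := (unit M).
Local Notation "f ⊞ g" := (bmap M f g) (at level 38, left associativity).

Lemma unit_compat_unique (F : AddFunctor M) (h k : Hom (F I) I) :
  unit_compat h -> unit_compat k -> h = k.
Proof.
intros Hh Hk. apply (@translate_faithful C G M O (F I)).
apply (cancel_l G) with (f := fwd (lunit M (F I))).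
apply (cancel_r G) with (f := mu F I I).
now rewrite Hh, Hk.
Qed.

(* The failure [phi] of compatibility is a natural automorphism of [F];
   associativity gives [phi (X ⊕ Y) = phi X ⊕ id] up to [mu], and [h] is chosen
   so that [phi 0 = id]. *)
Lemma unit_compat_exists (F : AddFunctor M) :
  assoc_compat F -> exists h : Hom (F I) I, unit_compat h.
Proof.
intro HF.
destruct (G (mu F I I)) as [m [_ mr]].
(* Fullness of [- ⊞ F I] solves the compatibility equation at [I] for [h]. *)
destruct (@translate_full C G M O (F I) (F I) I
  (bwd (lunit M (F I)) ∘ fmap F (lunit M I) ∘ m)) as [h hE].
exists h.
assert (h0 : lunit M (F I) ∘ (h ⊞ idm (F I)) ∘ mu F I I = fmap F (lunit M I)).
{ apply (cancel_r G) with (f := m).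
  rewrite <- comp_assoc, mr, comp_id_r, hE, !comp_assoc, fwd_bwd.
  now rewrite comp_id_l. }
(* Associativity of [mu] carries the case [I] to every object [I ⊞ Y]. *)
assert (h1 : forall Y, lunit M (F (M I Y)) ∘ (h ⊞ idm (F (M I Y))) ∘ mu F I (M I Y)
   = fmap F (lunit M (M I Y))).
{ intro Y. apply (cancel_l G) with (f := mu F I Y).
  rewrite <- (lunit_tens G M I Y), fmap_comp.
  rewrite !comp_assoc, mu_nat, (fmap_id G), <- h0, !bmap_l.
  rewrite <- !(comp_assoc (_ ∘ _)), (comp_assoc (mu F I I ⊞ _)), HF.
  rewrite <- !lunit_nat, <- (lunit_tens G M (F I) (F Y)).
  rewrite <- !comp_assoc. f_equal. rewrite !comp_assoc.
  rewrite <- assoc_nat, bmap_id.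
  rw (bmap_rl M h (mu F I Y)). rw (bmap_lr M h (mu F I Y)). reflexivity. }
(* Naturality along [lunit M Y] descends from [I ⊞ Y] to [Y]. *)
intro Y. apply (cancel_r G) with (f := fmap F (idm I ⊞ lunit M Y)).
rewrite <- fmap_comp, lunit_nat, fmap_comp, <- h1.
rewrite !comp_assoc, <- lunit_nat.
rw (mu_nat F (idm I) (lunit M Y)). rewrite (fmap_id G).
rw (bmap_lr M h (fmap F (lunit M Y))).
now rw (bmap_rl M h (fmap F (lunit M Y))).
Qed.

(** The braiding exchanges the two unit constraints and moves [h] to the other summand; this yields
    (L12) and (L13). *)
Lemma unit_compat_right (S : Symmetry M) (F : AddFunctor M) (h : Hom (F I) I) :
  (forall X Y : C,
     braid S (F X) (F Y) ∘ mu F X Y = mu F Y X ∘ fmap F (braid S X Y)) ->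
  unit_compat h ->
  forall B : C,
    runit M (F B) ∘ (idm (F B) ⊞ h) ∘ mu F B I = fmap F (runit M B).
Proof.
intros HS Hh B.
rewrite <- !(lunit_braid G S), fmap_comp, <- Hh.
rewrite <- (comp_assoc _ (mu F I B)), <- HS.
rw (braid_nat S (idm (F B)) h). reflexivity.
Qed.

Lemma unit_compat_transport (F F' : AddFunctor M) (h' : Hom (F' I) I)
    (t : forall X : C, Hom (F X) (F' X)) :
  (forall (X Y : C) (f : Hom X Y), t Y ∘ fmap F f = fmap F' f ∘ t X) ->
  (forall X Y : C, (t X ⊞ t Y) ∘ mu F X Y = mu F' X Y ∘ t (M X Y)) ->
  unit_compat h' -> unit_compat (F:=F) (h' ∘ t I).
Proof.
intros Hnat Hmu Hh' B. apply (cancel_l G) with (f := t B).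
rewrite Hnat, <- Hh'. rwb (Hmu I B). rewrite <- lunit_nat.
rw (bmap_rl M (h' ∘ t I) (t B)).
rw (eq_sym (bmap_comp M h' (t I) (idm (F' B)) (t B))).
now rewrite comp_id_l.
Qed.

Lemma unit_compat_natural (F F' : AddFunctor M) (h : Hom (F I) I)
    (h' : Hom (F' I) I) (t : forall X : C, Hom (F X) (F' X)) :
  (forall (X Y : C) (f : Hom X Y), t Y ∘ fmap F f = fmap F' f ∘ t X) ->
  (forall X Y : C, (t X ⊞ t Y) ∘ mu F X Y = mu F' X Y ∘ t (M X Y)) ->
  unit_compat h -> unit_compat h' -> h = h' ∘ t I.
Proof.
intros Hnat Hmu Hh Hh'.
apply unit_compat_unique; [exact Hh | now apply unit_compat_transport].
Qed.

Definition id_functor : AddFunctor M.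
Proof.
refine {| fobj := fun X => X; fmap := fun X Y f => f;
  mu := fun X Y => idm (M X Y) |}.
- reflexivity.
- intros. now rewrite comp_id_l, comp_id_r.
Defined.

Lemma id_functor_unit : unit_compat (F:=id_functor) (idm I).
Proof. intro B. cbn. now rewrite bmap_id, !comp_id_r. Qed.

Definition comp_functor (F' F : AddFunctor M) : AddFunctor M.
Proof.
refine {| fobj := fun X => F' (F X); fmap := fun X Y f => fmap F' (fmap F f);
  mu := fun X Y => mu F' (F X) (F Y) ∘ fmap F' (mu F X Y) |}.
- intros. now rewrite !fmap_comp.
- intros. rewrite <- comp_assoc, <- fmap_comp, mu_nat, fmap_comp.
  now rewrite !comp_assoc, mu_nat.
Defined.

Lemma comp_functor_unit (F' F : AddFunctor M) (h' : Hom (F' I) I)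
    (h : Hom (F I) I) :
  unit_compat h' -> unit_compat h ->
  unit_compat (F:=comp_functor F' F) (h' ∘ fmap F' h).
Proof.
intros Hh' Hh B. cbn.
rewrite <- Hh, !fmap_comp, <- Hh', bmap_l, <- !comp_assoc. do 2 f_equal.
rewrite !comp_assoc. f_equal.
now rewrite mu_nat, (fmap_id G).
Qed.

End UnitComparison.

(** * Null isomorphisms *)

Section Sum.
Variable D : DistrData.
Hypothesis G : is_groupoid D.

Lemma interchange_nat (U U' V V' Z Z' T T' : D)
    (u : Hom U U') (v : Hom V V') (z : Hom Z Z') (t : Hom T T') :
  interchange U' V' Z' T' ∘ ((u ⊕m v) ⊕m (z ⊕m t))
  = ((u ⊕m z) ⊕m (v ⊕m t)) ∘ interchange U V Z T.
Proof.
unfold interchange.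
apply paste with (y := u ⊕m (v ⊕m (z ⊕m t))).
2: apply bwd_nat, assoc_nat.
apply paste with (y := u ⊕m ((v ⊕m z) ⊕m t)).
2: apply whisker, assoc_nat.
apply paste with (y := u ⊕m ((z ⊕m v) ⊕m t)).
2: { apply whisker. rewrite <- !bmap_comp, braid_nat.
     now rewrite comp_id_l, comp_id_r. }
apply paste with (y := u ⊕m (z ⊕m (v ⊕m t))).
2: apply whisker, bwd_nat, assoc_nat.
apply assoc_nat.
Qed.

Lemma interchange_unit (X Y : D) :
  g⁺ (X ⊕ Y) ∘ (g⁺ zero ⊕m idm (X ⊕ Y)) ∘ interchange zero X zero Y
  = g⁺ X ⊕m g⁺ Y.
Proof.
(* Moving [zero] to the left of [X] and absorbing it there amounts to [d⁺ X ⊕m idm Y] after [a⁺], so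
   the triangle applies. *)
assert (e : g⁺ (X ⊕ Y) ∘ bwd (a⁺ zero X Y) ∘ (c⁺ X zero ⊕m idm Y) ∘ a⁺ X zero Y
   = idm X ⊕m g⁺ Y).
{ rewrite <- (lunit_tens G add X Y), <- (comp_assoc _ _ (bwd _)), fwd_bwd.
  rewrite comp_id_r, <- bmap_l, (lunit_braid G add_sym). apply triangle. }
unfold interchange.
rw (lunit_tens G add zero (X ⊕ Y)).
rewrite <- (lunit_nat add (g⁺ (X ⊕ Y))).
rewrite !(fun T T' U V W f g => comp_pre (eq_sym (@bmap_r _ _ T U V W g f)) (T:=T')).
rewrite !comp_assoc, e.
rewrite lunit_nat, <- comp_assoc.
rewrite <- (lunit_tens G add X (zero ⊕ Y)).
now rewrite <- (comp_assoc _ _ (bwd _)), fwd_bwd, comp_id_r, bmap_rl.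
Qed.

(* The additivity constraint occurring in (4). *)
Definition sum_functor (F F' : AddFunctor (@add D)) : AddFunctor (@add D).
Proof.
refine {| fobj := fun X => F X ⊕ F' X; fmap := fun X Y f => fmap F f ⊕m fmap F' f;
  mu := fun X Y => interchange (F X) (F Y) (F' X) (F' Y) ∘ (mu F X Y ⊕m mu F' X Y) |}.
- intros. now rewrite !fmap_comp, bmap_comp.
- intros. apply paste with (1 := interchange_nat _ _ _ _).
  now rewrite <- !bmap_comp, !mu_nat.
Defined.

Lemma sum_functor_unit (F F' : AddFunctor (@add D)) (h : Hom (F zero) zero)
    (h' : Hom (F' zero) zero) :
  unit_compat h -> unit_compat h' ->
  unit_compat (F:=sum_functor F F') (g⁺ zero ∘ (h ⊕m h')).
Proof.
intros Hh Hh' B. cbn.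
rewrite <- Hh, <- Hh', !bmap_comp, <- interchange_unit, !comp_assoc. f_equal.
rewrite bmap_l. rw (interchange_nat h (idm (F B)) h' (idm (F' B))).
now rewrite bmap_id.
Qed.

End Sum.

(** * Multiplication by a fixed object as an additive functor *)

Section Multiplication.
Variable D : DistrData.
Hypothesis G : is_groupoid D.

Definition mul_left (A : D) : AddFunctor (@add D).
Proof.
refine {| fobj := fun X => A ⊗ X; fmap := fun X Y f => idm A ⊗m f;
  mu := fun X Y => 𝔏 A X Y |}.
- intros. apply bmap_r.
- intros. apply distl_nat.
Defined.

Definition mul_right (A : D) : AddFunctor (@add D).
Proof.
refine {| fobj := fun X => X ⊗ A; fmap := fun X Y f => f ⊗m idm A;
  mu := fun X Y => ℜ X Y A |}.
- intros. apply bmap_l.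
- intros. apply distr_nat.
Defined.

Hypothesis O : has_opposites (@add D).
Hypothesis H1 : Ann1 D.

Lemma null_left_exists (A : D) :
  exists h : Iso (A ⊗ zero) zero, L10 h.
Proof.
destruct (unit_compat_exists G O (F:=mul_left A)) as [f Hf].
- intros X Y Z. apply H1.
- destruct (groupoid_iso G f) as [h e]. exists h. subst f. exact Hf.
Qed.

Lemma null_right_exists (A : D) :
  exists h : Iso (zero ⊗ A) zero, L11 h.
Proof.
destruct (unit_compat_exists G O (F:=mul_right A)) as [f Hf].
- intros X Y Z. apply H1.
- destruct (groupoid_iso G f) as [h e]. exists h. subst f. exact Hf.
Qed.

Lemma L10_unique (A : D) (h k : Hom (A ⊗ zero) zero) : L10 h -> L10 k -> h = k.
Proof. exact (unit_compat_unique G O (F:=mul_left A) (h:=h) (k:=k)). Qed.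

Lemma L11_unique (A : D) (h k : Hom (zero ⊗ A) zero) : L11 h -> L11 k -> h = k.
Proof. exact (unit_compat_unique G O (F:=mul_right A) (h:=h) (k:=k)). Qed.

Lemma L10_L12 (A : D) (h : Hom (A ⊗ zero) zero) : L10 h -> L12 h.
Proof.
refine (unit_compat_right G (S:=add_sym) (F:=mul_left A) _).
intros X Y. apply H1.
Qed.

Lemma L11_L13 (A : D) (h : Hom (zero ⊗ A) zero) : L11 h -> L13 h.
Proof.
refine (unit_compat_right G (S:=add_sym) (F:=mul_right A) _).
intros X Y. apply H1.
Qed.

End Multiplication.

(** * Verification of the distributivity axioms *)

Theorem proposition5p1 (A : SymAnnCategory) :
  exists S : DistributivityCategoryOn (sann_sym A),
    (forall (X : A) (h : Iso (X ⊗ zero) zero),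
        L10 h -> L12 h -> fwd h = fwd (nullL S X))
    /\ (forall (X : A) (h : Iso (zero ⊗ X) zero),
        L11 h -> L13 h -> fwd h = fwd (nullR S X)).
Proof.
assert (G := @ann_groupoid A). assert (O := @ann_opposites A).
assert (H1 := @ann_1 A). destruct (@ann_2 A) as [e1 [e2 [e3 e4]]].
destruct (@ann_3 A) as [e51 e52]. assert (e6 := @sann_compat A).
pose (c := sann_sym A). fold c in e6.
(* Choice turns objectwise existence into families; by uniqueness the chosen morphisms are
   canonical. *)
set (L := fun X => proj1_sig (constructive_indefinite_description _
  (null_left_exists G O H1 X))).
set (R := fun X => proj1_sig (constructive_indefinite_description _
  (null_right_exists G O H1 X))).
assert (HL : forall X, L10 (L X)) by (intro X; apply proj2_sig).
assert (HR : forall X, L11 (R X)) by (intro X; apply proj2_sig).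
clearbody L R.
assert (transport := fun F F' => @unit_compat_natural _ G _ O F F').
assert (l6 : forall X, fwd (L X) = R X ∘ braid c X zero).
{ intro X. apply (transport (mul_left X) (mul_right X) (L X) (R X)
    (fun Y => braid c X Y)); [ | | apply HL | apply HR].
  - intros. apply braid_nat.
  - intros. symmetry. apply e6. }
(* [𝔏 Z X Y], read in the variable [Z], goes from [- ⊗ (X ⊕ Y)] to a sum of functors, and (4) is its
   additivity. *)
assert (l2 : forall X Y,
  g⁺ zero ∘ (R X ⊕m R Y) ∘ 𝔏 zero X Y = R (X ⊕ Y)).
{ intros X Y. symmetry.
  apply (transport (mul_right (X ⊕ Y)) (sum_functor (mul_right X) (mul_right Y))
    (R (X ⊕ Y)) (g⁺ zero ∘ (R X ⊕m R Y)) (fun Z => 𝔏 Z X Y)).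
  - intros Z Z' f. cbn. rewrite <- (bmap_id add X Y). apply distl_nat.
  - intros. symmetry. apply e4.
  - apply HR.
  - apply (sum_functor_unit G (F:=mul_right X) (F':=mul_right Y)); apply HR. }
unshelve eexists.
- unshelve refine {| nullL := L; nullR := R |}.
  + exact H1.
  + exact (@ann_2 A).
  + exact (@ann_3 A).
  + exact (@sann_compat A).
  (* Multiplying by [f] is an additive transformation since [𝔏] is natural, so naturality of the
     null isomorphisms is again transport. *)
  + intros X Y f. symmetry.
    apply (transport (mul_left X) (mul_left Y) (L X) (L Y)
      (fun Z => f ⊗m idm Z)); [ | | apply HL | apply HL]; cbn; intros.
    * now rewrite bmap_lr, bmap_rl.
    * symmetry. rewrite <- bmap_id. apply distl_nat.
  + intros X Y f. symmetry.
    apply (transport (mul_right X) (mul_right Y) (R X) (R Y)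
      (fun Z => idm Z ⊗m f)); [ | | apply HR | apply HR]; cbn; intros.
    * now rewrite bmap_lr, bmap_rl.
    * symmetry. rewrite <- bmap_id. apply distr_nat.
  + rewrite l6. unfold c. now rewrite sann_sym_zero, comp_id_r.
  + exact l2.
  + intros X Y. rewrite !l6, <- l2, bmap_comp, <- (lunit_unit G add).
    rewrite <- !comp_assoc. do 2 f_equal.
    (* Precomposed with this braiding, (6) replaces [ℜ] by [𝔏] and all braidings cancel in pairs. *)
    apply (cancel_r G) with (f := fwd (braid c zero (X ⊕ Y))).
    rewrite <- !comp_assoc, e6, braid_invol, comp_id_r.
    rewrite comp_assoc, <- bmap_comp, !braid_invol, bmap_id.
    now rewrite comp_id_l.
  (* The inserted identity is the unit comparison of the identity functor, the target of [l×]. *)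
  + rewrite <- (comp_id_l (l× zero)).
    apply (transport (mul_left one) (id_functor add) (L one) (idm zero)
      (fun X => fwd (l× X))); [ | | apply HL | apply id_functor_unit]; cbn; intros.
    * apply lunit_nat.
    * now rewrite comp_id_l.
  + rewrite <- (comp_id_l (r× zero)).
    apply (transport (mul_right one) (id_functor add) (R one) (idm zero)
      (fun X => fwd (r× X))); [ | | apply HR | apply id_functor_unit]; cbn; intros.
    * apply runit_nat.
    * now rewrite comp_id_l.
  + exact l6.
  (* The associator as a transformation in its first, middle and last argument gives (L7), (L8),
     (L9), with additivity (2), (3), (1). *)
  + intros X Y.
    apply (transport (mul_right (X ⊗ Y)) (comp_functor (mul_right Y) (mul_right X))
      (R (X ⊗ Y)) (R Y ∘ (R X ⊗m idm Y)) (fun Z => fwd (a× Z X Y)));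
      [ | | apply HR | ]; cbn; intros.
    * rewrite <- bmap_id. apply assoc_nat.
    * apply e2.
    * apply (comp_functor_unit G (F':=mul_right Y) (F:=mul_right X)); apply HR.
  + intros X Y.
    apply (transport (comp_functor (mul_left X) (mul_right Y))
      (comp_functor (mul_right Y) (mul_left X))
      (L X ∘ (idm X ⊗m R Y)) (R Y ∘ (L X ⊗m idm Y)) (fun Z => fwd (a× X Z Y)));
      cbn; intros.
    * apply assoc_nat.
    * rewrite comp_assoc. symmetry. apply e3.
    * apply (comp_functor_unit G (F':=mul_left X) (F:=mul_right Y));
        [apply HL | apply HR].
    * apply (comp_functor_unit G (F':=mul_right Y) (F:=mul_left X));
        [apply HR | apply HL].
  + intros X Y. symmetry.
    apply (transport (comp_functor (mul_left X) (mul_left Y)) (mul_left (X ⊗ Y))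
      (L X ∘ (idm X ⊗m L Y)) (L (X ⊗ Y)) (fun Z => fwd (a× X Y Z)));
      [ | | | apply HL]; cbn; intros.
    * rewrite <- bmap_id. apply assoc_nat.
    * rewrite comp_assoc. symmetry. apply e1.
    * apply (comp_functor_unit G (F':=mul_left X) (F:=mul_left Y)); apply HL.
  + exact HL.
  + exact HR.
  + intro X. now apply L10_L12.
  + intro X. now apply L11_L13.
- cbn. split; intros X h Hh _.
  + now apply L10_unique.
  + now apply L11_unique.
Qed.
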